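(* Let $a_1,a_2>0$, put $a_3=a_2$, $a_4=a_1$, and let $q_j\in L^2(0,a_j)$ be real-valued for $j=1,2,3,4$. Let $\Gamma$ be the infinite rectangular graph with edge lengths $a_1$ and $a_2$, carrying the periodic Schr\''odinger operator with potentials $q_1,\dots,q_4$ on the four edges of the fundamental domain, and for $\theta_1,\theta_2\in[-\pi,\pi]$ let $H^{(\theta_1,\theta_2)}$ be the associated Bloch Hamiltonian (see context). Then the dispersion relation is \begin{align*} &(C_1S_2S_3S_4)'+(S_1C_2S_3S_4)'+(S_1S_2C_3S_4)'+(S_1S_2S_3C_4)'\\ &\quad=2\big[(S_1S_3+S_2S_4)\cos\theta_1+(S_1S_2+S_3S_4)\cos\theta_2+S_2S_3\cos(\theta_1+\theta_2)+S_1S_4\cos(\theta_1-\theta_2)\big]. \end{align*} That is, for all $\theta_1,\theta_2\in[-\pi,\pi]$ and all $\rho$, the number $\lambda=\rho^2$ is an eigenvalue of $H^{(\theta_1,\theta_2)}$ if and only if this equation holds.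
   Context: Graph and fundamental domain. $\Gamma\subset\mathbb{R}^2$ is the rectangular grid graph with vertices $(ma_1,na_2)$, $m,n\in\mathbb{Z}$, and the horizontal (length $a_1$) and vertical (length $a_2$) segments joining neighbouring vertices as edges. The period vectors are $k_1=(a_1,-a_2)$ and $k_2=(a_1,a_2)$. The fundamental domain $W$ consists of the four edges issuing from the origin: edge 1 runs to $(a_1,0)$, edge 2 to $(0,-a_2)$, edge 3 to $(0,a_2)$, edge 4 to $(-a_1,0)$. Edge $j$ is identified with $[0,a_j]$, with $x=0$ at the origin. The potential on $\Gamma$ is the $(k_1,k_2)$-periodic extension of $q_1,\dots,q_4$. Bloch Hamiltonian. A function on $\Gamma$ satisfies the Floquet-Bloch condition with quasi-momentum $(\theta_1,\theta_2)$ if $y(x+p_1k_1+p_2k_2)=e^{i(p_1\theta_1+p_2\theta_2)}y(x)$ for all $(p_1,p_2)\in\mathbb{Z}^2$. The operator $H^{(\theta_1,\theta_2)}$ acts as $-y_j''+q_jy_j$ on each edge, on functions that are $H^2$ on each edge, satisfy the Floquet-Bloch condition, and satisfy the Neumann (continuity-Kirchhoff) condition at each vertex: $y$ is continuous there and the sum of the outgoing derivatives along the incident edges is zero. Equivalently, $\lambda$ is an eigenvalue of $H^{(\theta_1,\theta_2)}$ iff there is $(y_1,\dots,y_4)\neq 0$ with $-y_j''+q_jy_j=\lambda y_j$ on $(0,a_j)$ such that $$y_1(0)=y_2(0)=y_3(0)=y_4(0),\qquad \sum_{j=1}^4y_j'(0)=0,$$ $$y_1(a_1)=e^{i\theta_2}y_2(a_2)=e^{i\theta_1}y_3(a_2)=e^{i(\theta_1+\theta_2)}y_4(a_1),$$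 $$y_1'(a_1)+e^{i\theta_2}y_2'(a_2)+e^{i\theta_1}y_3'(a_2)+e^{i(\theta_1+\theta_2)}y_4'(a_1)=0.$$ Notation. For $\lambda=\rho^2$, $C_j(x,\rho)$ and $S_j(x,\rho)$ are the solutions of $-y''+q_jy=\lambda y$ on $[0,a_j]$ with $C_j(0,\rho)=S_j'(0,\rho)=1$, $C_j'(0,\rho)=S_j(0,\rho)=0$ (prime is $d/dx$). Write $C_j=C_j(a_j,\rho)$, $S_j=S_j(a_j,\rho)$, $C_j'=C_j'(a_j,\rho)$, $S_j'=S_j'(a_j,\rho)$. The prime of a product is given by the Leibniz rule, e.g. $(C_1S_2S_3S_4)'=C_1'S_2S_3S_4+C_1S_2'S_3S_4+C_1S_2S_3'S_4+C_1S_2S_3S_4'$. *)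

(* Defs.v *)
From HB Require Import structures.
From mathcomp Require Import all_boot all_order all_algebra.
From mathcomp Require Import all_classical all_reals all_analysis.
From mathcomp Require Import complex.

Set Implicit Arguments.
Unset Strict Implicit.
Unset Printing Implicit Defensive.

Import Order.TTheory GRing.Theory Num.Theory.
Import numFieldNormedType.Exports.

Local Open Scope classical_set_scope.
Local Open Scope complex_scope.
Local Open Scope ring_scope.

(* e^{it} *)
Definition cis (R : realType) (t : R) : R[i] := cos t +i* sin t.

Definition L2_real (R : realType) (a : R) (f : R -> R) : Prop :=
  (f \_ `]0, a[) \in Lfun (@lebesgue_measure R) 2%:E.

Definition L2_complex (R : realType) (a : R) (f : R -> R[i]) : Prop :=
  L2_real a (fun x => complex.Re (f x)) /\
  L2_real a (fun x => complex.Im (f x)).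

Definition Cintegral (R : realType) (A : set R) (f : R -> R[i]) : R[i] :=
  (\int[lebesgue_measure]_(x in A) complex.Re (f x)) +i*
  (\int[lebesgue_measure]_(x in A) complex.Im (f x)).

Definition primitive_on (R : realType) (a : R) (f F : R -> R[i]) : Prop :=
  forall x : R, 0 <= x <= a -> F x = F 0 + Cintegral `[0, x] f.

(* y is in H^2(0, a), with derivative dy and second derivative ddy: y and dy
   are absolutely continuous on [0, a] and ddy is in L^2(0, a).  The function
   dy is determined by y on the whole of [0, a], being continuous there, so
   that dy 0 and dy a are the one-sided derivatives of y at the end points. *)
Definition H2 (R : realType) (a : R) (y dy ddy : R -> R[i]) : Prop :=
  [/\ L2_complex a ddy, primitive_on a dy y & primitive_on a ddy dy].

Definition ae_eq_on (R : realType) (a : R) (f g : R -> R[i]) : Prop :=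
  {ae @lebesgue_measure R, forall x : R, 0 < x < a -> f x = g x}.

Definition ode_solution (R : realType) (a : R) (q : R -> R) (lam : R[i])
    (y dy : R -> R[i]) : Prop :=
  exists ddy : R -> R[i], H2 a y dy ddy /\
    ae_eq_on a (fun x => - ddy x + (q x)%:C * y x) (fun x => lam * y x).

(* The vertex (m a1, n a2) of the grid is represented by (m, n), so that
   k1 = (a1, -a2) and k2 = (a1, a2) become (1, -1) and (1, 1).  The type [edge]
   lists the edges of W; since they leave the origin in the directions right,
   down, up and left respectively, it also lists the four directions in which
   edges leave an arbitrary vertex of the grid. *)
Inductive edge : Set := e1 | e2 | e3 | e4.

Definition edge_length (R : realType) (a1 a2 : R) (j : edge) : R :=
  match j with e1 | e4 => a1 | e2 | e3 => a2 end.

Definition opposite (j : edge) : edge :=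
  match j with e1 => e4 | e2 => e3 | e3 => e2 | e4 => e1 end.

Definition step (v : int * int) (j : edge) : int * int :=
  match j with
  | e1 => (v.1 + 1, v.2)
  | e2 => (v.1, v.2 - 1)
  | e3 => (v.1, v.2 + 1)
  | e4 => (v.1 - 1, v.2)
  end.

(* v + p1 k1 + p2 k2 *)
Definition translate (v p : int * int) : int * int :=
  (v.1 + p.1 + p.2, v.2 - p.1 + p.2).

(* Functions on the graph are given in arc length coordinates: y v j x is the
   value on the edge leaving the vertex v in direction j, at distance x from v.
   Every edge is thus described twice, once from each of its ends, and
   [is_graph_function] says that the two descriptions agree. *)
Definition graph_function (R : realType) : Type :=
  int * int -> edge -> R -> R[i].

Definition is_graph_function (R : realType) (a1 a2 : R)
    (y : graph_function R) : Prop :=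
  forall (v : int * int) (j : edge) (x : R), 0 <= x <= edge_length a1 a2 j ->
    y v j x = y (step v j) (opposite j) (edge_length a1 a2 j - x).

(* The (k1, k2)-periodic extension of q_1, ..., q_4.  The vertices (m, n) with
   m + n even are the translates of the origin; if m + n is odd, the edge
   leaving (m, n) in direction j is, seen from its other end, a translate of
   edge [opposite j] of W. *)
Definition potential (R : realType) (a1 a2 : R) (q : edge -> R -> R)
    (v : int * int) (j : edge) (x : R) : R :=
  if (2 %| v.1 + v.2)%Z then q j x
  else q (opposite j) (edge_length a1 a2 j - x).

Definition floquet_bloch (R : realType) (a1 a2 theta1 theta2 : R)
    (y : graph_function R) : Prop :=
  forall (v p : int * int) (j : edge) (x : R),
    0 <= x <= edge_length a1 a2 j ->
    y (translate v p) j x =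
      cis (p.1%:~R * theta1 + p.2%:~R * theta2) * y v j x.

(* Continuity of y and vanishing of the sum of its outgoing derivatives. *)
Definition neumann_at (R : realType) (y dy : graph_function R)
    (v : int * int) : Prop :=
  (forall i j : edge, y v i 0 = y v j 0) /\
  dy v e1 0 + dy v e2 0 + dy v e3 0 + dy v e4 0 = 0.

(* The graph of the operator H^(theta1, theta2): y is in its domain and is
   mapped to z. *)
Definition bloch_hamiltonian (R : realType) (a1 a2 : R) (q : edge -> R -> R)
    (theta1 theta2 : R) (y z : graph_function R) : Prop :=
  [/\ is_graph_function a1 a2 y,
      floquet_bloch a1 a2 theta1 theta2 y &
      exists dy ddy : graph_function R,
        [/\ forall v j, H2 (edge_length a1 a2 j) (y v j) (dy v j) (ddy v j),
            forall v, neumann_at y dy v &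
            forall v j, ae_eq_on (edge_length a1 a2 j) (z v j)
              (fun x => - ddy v j x
                        + (potential a1 a2 q v j x)%:C * y v j x)]].

(* Elements of the domain are continuous on every closed edge, so that being
   nonzero at one point is the same as being nonzero in L^2. *)
Definition bloch_eigenvalue (R : realType) (a1 a2 : R) (q : edge -> R -> R)
    (theta1 theta2 : R) (lam : R[i]) : Prop :=
  exists y : graph_function R,
    bloch_hamiltonian a1 a2 q theta1 theta2 y (fun v j x => lam * y v j x) /\
    exists v j x, 0 <= x <= edge_length a1 a2 j /\ y v j x != 0.

(* (f g h k)' by the Leibniz rule, each factor being given as the pair of its
   value and the value of its derivative. *)
Definition leibniz4 (A : pzRingType) (f g h k : A * A) : A :=
  f.2 * g.1 * h.1 * k.1 + f.1 * g.2 * h.1 * k.1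
  + f.1 * g.1 * h.2 * k.1 + f.1 * g.1 * h.1 * k.2.

(* Main.v *)
(* Integration by parts for absolutely continuous functions, a consequence of
   Fubini's theorem on a triangle, shows that the Wronskian of two solutions of
   the equation on an edge is constant.  Hence C S' - C' S = 1, and every
   solution is y = y(0) C + y'(0) S, so no Gronwall argument is needed.
   By the Floquet-Bloch condition an eigenfunction is determined by its
   restriction y_j = A C_j + B_j S_j to the four edges of W, and the Neumann
   conditions have only to be imposed at the vertices (0, 0) and (a_1, 0).  This
   is a linear system for A, B_1, ..., B_4 and the common value E of the
   w_j y_j(a_j), where w_j is the Floquet-Bloch phase of edge j.  Its
   determinant, simplified with C_j S_j' - C_j' S_j = 1 and |w_j| = 1, is the
   difference of the two sides of the dispersion relation. *)

Require Import Defs.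
From HB Require Import structures.
From mathcomp Require Import all_boot all_order all_algebra.
From mathcomp Require Import all_classical all_reals all_analysis.
From mathcomp Require Import complex.
From mathcomp Require Import measurable_realfun.
From mathcomp Require Import zify ring lra.

Set Implicit Arguments.
Unset Strict Implicit.
Unset Printing Implicit Defensive.

Import Order.TTheory GRing.Theory Num.Theory.
Import numFieldNormedType.Exports.

Local Open Scope classical_set_scope.
Local Open Scope complex_scope.
Local Open Scope ring_scope.

(** * Absolutely continuous functions *)

Section Primitives.
Context {R : realType}.
Notation mu := (@lebesgue_measure R).

Definition integrable_to (a : R) (f : R -> R) : Prop :=
  mu.-integrable `[0, a] (EFin \o f).

(* [F] is absolutely continuous on [0, a] with derivative [f]. *)
Definition is_prim (a : R) (f F : R -> R) : Prop :=
  integrable_to a f /\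
  forall x, 0 <= x <= a -> F x = F 0 + \int[mu]_(t in `[0, x]) f t.

Lemma L2_integrable_to (a : R) (f : R -> R) : L2_real a f -> integrable_to a f.
Proof.
move=> f2.
have m1 : (\1_`]0%R, a[ : R -> R) \in Lfun mu 2%:E.
  rewrite inE; apply/andP; split; rewrite inE/=; first exact: measurable_indic.
  rewrite /finite_norm unlock /= poweR_lty//.
  under eq_integral => x _.
    rewrite (_ : `|_| `^ 2 = \1_`]0%R, a[ x)%R; first over.
    by rewrite indicE; case: (_ \in _); rewrite ?normr1 ?powR1// normr0 powR0.
  rewrite integral_indic//= setIT lebesgue_measure_itv/=.
  by case: ifPn => // _; rewrite oppr0 adde0 ltry.
have := Lfun2_mul_Lfun1 f2 m1.
move/Lfun1_integrable => fi.
have {}fi : mu.-integrable `]0, a[ (EFin \o f).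
  have := integrable_restrict mu (measurable_itv `]0, a[) measurableT
    (EFin \o f).
  rewrite setTI => H; apply/H; apply: eq_integrable fi => //= x _.
  rewrite !patchE/= indicE; case: ifPn => xa; rewrite /= ?mulr1 ?mulr0 ?mul0r//.
have mf : measurable_fun `[0, a] f.
  move/integrableP : fi => [/measurable_EFinP mf _].
  exact: measurable_fun_itv_cc mf.
apply/integrableP; split; first exact/measurable_EFinP.
move/integrableP : fi => [mf' ]; congr (_ < _)%E; apply/esym.
apply: integral_itv_bndoo; exact: measurableT_comp.
Qed.

Lemma integrable_to_sub (a x : R) f : 0 <= x <= a ->
  integrable_to a f -> integrable_to x f.
Proof.
move=> /andP[x0 xa]; apply: integrableS => //.
by apply: subset_itvl; rewrite bnd_simp.
Qed.

Lemma is_prim_continuous a f F : 0 <= a -> is_prim a f F ->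
  {within `[0, a], continuous F}.
Proof.
move=> a0 [fi FE].
have : {within `[0, a], continuous
   (fun x => F 0 + \int[mu]_(t in `[0, x]) f t : R)}.
  apply: within_continuousD; first by move=> x; exact: cvg_cst.
  exact: parameterized_integral_continuous.
apply: subspace_eq_continuous => x /=; rewrite inE/= in_itv/= => xa.
exact/esym/FE.
Qed.

Lemma is_primD a f F g G : is_prim a f F -> is_prim a g G ->
  is_prim a (f \+ g) (F \+ G).
Proof.
move=> [fi FE] [gi GE]; split=> [|x xa /=].
  by apply: eq_integrable (integrableD _ fi gi) => //.
rewrite RintegralD//; last 2 first.
- exact: integrable_to_sub xa fi.
- exact: integrable_to_sub xa gi.
by rewrite (FE x)// (GE x)// addrACA.
Qed.

Lemma is_primZ a c f F : is_prim a f F -> is_prim a (c \*o f) (c \*o F).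
Proof.
move=> [fi FE]; split=> [|x xa /=].
  by apply: eq_integrable (integrableZl _ c fi) => //.
rewrite RintegralZl//; first by rewrite (FE x)// mulrDr.
exact: integrable_to_sub xa fi.
Qed.

Lemma is_primB a f F g G : is_prim a f F -> is_prim a g G ->
  is_prim a (f \- g) (F \- G).
Proof.
move=> fF /(is_primZ (-1)) gG; have := is_primD fF gG.
by congr is_prim; apply/funext => x /=; rewrite mulN1r.
Qed.

Lemma is_prim_ae0 a f F : is_prim a f F ->
  {ae mu, forall x, 0 < x < a -> f x = 0} ->
  forall x, 0 <= x <= a -> F x = F 0.
Proof.
move=> [fi FE] f0 x xa; rewrite (FE x)//.
suff -> : \int[mu]_(t in `[0, x]) f t = 0 by rewrite addr0.
have fx := integrable_to_sub xa fi.
move/integrableP : fx => [mf _].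
rewrite /Rintegral integral_itv_bndoo; last first.
  apply: measurable_funS mf => //; exact: subset_itv_oo_cc.
rewrite (@ae_eq_integral _ _ _ mu _ (cst 0%E))//; first by rewrite integral0.
- apply: measurable_funS mf => //; exact: subset_itv_oo_cc.
- move: f0; apply: filterS; first exact: (ae_filter_ringOfSetsType mu).
  move=> y /= + yx => ->//.
  move: yx xa; rewrite in_itv/= => /andP[-> yx] /andP[_ xa].
  exact: lt_le_trans xa.
Qed.

Lemma measurable_patch_itv (x : R) f : integrable_to x f ->
  measurable_fun setT (f \_ `[0, x]).
Proof.
move=> /integrableP[/measurable_EFinP mf _].
by apply: (iffLR (measurable_restrictT _ _)) mf.
Qed.

Lemma integrable_patch_itv (x : R) f : integrable_to x f ->
  mu.-integrable setT (EFin \o (f \_ `[0, x])).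
Proof.
move=> fi.
have := integrable_restrict mu (measurable_itv `[0, x]) measurableT (EFin \o f).
by rewrite setTI restrict_EFin => H; apply/H.
Qed.

Lemma integral_mul_restrict (A : set R) c f : measurable A ->
  mu.-integrable A (EFin \o f) ->
  (\int[mu]_t (c * (f \_ A) t)%:E = (c * \int[mu]_(t in A) f t)%:E)%E.
Proof.
move=> mA fi; under eq_integral do rewrite EFinM.
rewrite integralZl//; last first.
  have := integrable_restrict mu mA measurableT (EFin \o f).
  by rewrite setTI restrict_EFin => H; apply/H.
rewrite EFinM /Rintegral fineK; last exact: integrable_fin_num.
congr (_ * _)%E; rewrite [RHS]integral_mkcond; apply: eq_integral => t _.
by rewrite restrict_EFin.
Qed.

(* Both sides are the integral of [f s * g t] over [0 <= s <= t <= x]. *)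
Lemma fubini_triangle (x : R) f g : 0 <= x ->
  integrable_to x f -> integrable_to x g ->
  \int[mu]_(t in `[0, x]) (g t * \int[mu]_(s in `[0, t]) f s) =
  \int[mu]_(s in `[0, x]) (f s * \int[mu]_(t in `[s, x]) g t).
Proof.
move=> x0 fi gi.
pose f' := f \_ `[0, x]; pose g' := g \_ `[0, x].
have mf' : measurable_fun setT f' by exact: measurable_patch_itv.
have mg' : measurable_fun setT g' by exact: measurable_patch_itv.
have f'i : mu.-integrable setT (EFin \o f') by exact: integrable_patch_itv.
have g'i : mu.-integrable setT (EFin \o g') by exact: integrable_patch_itv.
pose L := [set z : R * R | z.1 <= z.2].
have mL : measurable L.
  have := @measurable_fun_le _ (R * R)%type R setT fst snd measurableT.
  by rewrite setTI; apply; [exact: measurable_fst|exact: measurable_snd].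
pose h (z : R * R) : R := f' z.1 * g' z.2 * \1_L z.
have mh : measurable_fun setT h.
  apply: measurable_funM; last exact: measurable_indic.
  apply: measurable_funM; first exact: (measurableT_comp mf').
  exact: (measurableT_comp mg').
have hi : (mu \x mu)%E.-integrable setT (EFin \o h).
  apply/integrable12ltyP; first exact/measurable_EFinP.
  have mf'n : measurable_fun setT (fun s => `|f' s|%:E).
    exact/measurable_EFinP/measurableT_comp.
  have mg'n : measurable_fun setT (fun s => `|g' s|%:E).
    exact/measurable_EFinP/measurableT_comp.
  have /integrableP[_ fy] := f'i; have /integrableP[_ gy] := g'i.
  apply: (@le_lt_trans _ _ (\int[mu]_s (`|f' s|%:E * \int[mu]_t `|g' t|%:E))%E).
    apply: ge0_le_integral => //.
    - by move=> s _; exact: integral_ge0.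
    - apply: (@measurable_fun_fubini_tonelli_F _ _ _ _ _ mu
        (abse \o (EFin \o h))) => //=.
      by apply: measurableT_comp => //; exact/measurable_EFinP.
    - by apply: emeasurable_funM => //; exact: measurable_cst.
    - move=> s _; rewrite -ge0_integralZl//.
      apply: ge0_le_integral => //.
      + apply: measurableT_comp => //; apply/measurable_EFinP.
        exact: (measurableT_comp mh).
      + by apply: emeasurable_funM => //; exact: measurable_cst.
      + move=> t _; rewrite /= -EFinM lee_fin !normrM ler_piMr//.
        by rewrite indicE; case: (_ \in _); rewrite ?normr1// normr0.
  rewrite ge0_integralZr//; last exact: integral_ge0.
  rewrite lte_mul_pinfty//; first exact: integral_ge0.
  by rewrite ge0_fin_numE//; exact: integral_ge0.
have := Fubini hi.
rewrite /=.
have inL s t : ((s, t) \in L) = (s <= t) by apply/idP/idP; rewrite inE.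
have E1 s : (\int[mu]_t (h (s, t))%:E =
    (f' s * \int[mu]_(t in `[s, x]) g t)%:E)%E.
  have [sx|sx] := boolP (s \in `[0, x]); last first.
    have f's0 : f' s = 0.
      by rewrite /f' patchE ifF//; apply/negbTE/negP; rewrite inE/= (negbTE sx).
    rewrite f's0 mul0r; under eq_integral do rewrite /h/= f's0 !mul0r.
    by rewrite integral0.
  have s0 : 0 <= s by move: sx; rewrite in_itv/= => /andP[].
  rewrite -integral_mul_restrict//; last first.
    by apply: integrableS gi => //; apply: subset_itvr; rewrite bnd_simp.
  apply: eq_integral => t _; rewrite /h/= -mulrA /g' indicE !patchE.
  congr (_ * _)%:E; rewrite inL !mem_setE/= !in_itv/=.
  have [st|ts] := leP s t; rewrite ?mulr0// mulr1 (le_trans s0 st)//.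
have E2 t : (\int[mu]_s (h (s, t))%:E =
    (g' t * \int[mu]_(s in `[0, t]) f s)%:E)%E.
  have [tx|tx] := boolP (t \in `[0, x]); last first.
    have g't0 : g' t = 0.
      by rewrite /g' patchE ifF//; apply/negbTE/negP; rewrite inE/= (negbTE tx).
    rewrite g't0 mul0r; under eq_integral do rewrite /h/= g't0 mulr0 mul0r.
    by rewrite integral0.
  have tx' : t <= x by move: tx; rewrite in_itv/= => /andP[].
  rewrite -integral_mul_restrict//; last first.
    by apply: integrableS fi => //; apply: subset_itvl; rewrite bnd_simp.
  apply: eq_integral => s _; rewrite /h/= -mulrA mulrCA /f' indicE !patchE.
  congr (_ * _)%:E; rewrite inL !mem_setE/= !in_itv/=.
  have [st|ts] := leP s t; rewrite ?mulr0// ?andbF// mulr1 (le_trans st tx')//.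
under eq_integral do rewrite E1.
under [in RHS]eq_integral do rewrite E2.
move=> E; rewrite Rintegral_mkcond [RHS]Rintegral_mkcond /Rintegral.
congr fine; apply/esym; apply: etrans (etrans _ E) _; apply: eq_integral => s _.
  congr EFin; rewrite /f' !patchE; case: ifP; rewrite ?mul0r//.
congr EFin; rewrite /g' !patchE; case: ifP; rewrite ?mul0r//.
Qed.

Lemma continuous_bounded (a : R) (F : R -> R) :
  {within `[0, a], continuous F} -> [bounded F x | x in `[0, a]].
Proof.
move=> cF.
have /compact_bounded[M [Mreal MF]] :=
  continuous_compact cF (@segment_compact _ 0 a).
by exists M; split => // r rM x xa; apply: (MF _ rM); exists x.
Qed.

Lemma continuous_measurable (a : R) (F : R -> R) :
  {within `[0, a], continuous F} -> measurable_fun `[0, a] F.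
Proof. by move=> cF; exact: subspace_continuous_measurable_fun. Qed.

Lemma integrable_toM (a : R) f F : {within `[0, a], continuous F} ->
  integrable_to a f -> integrable_to a (fun t => f t * F t).
Proof.
move=> cF fi.
have := integrableMl _ fi (continuous_measurable cF) (continuous_bounded cF).
by apply.
Qed.

Lemma integrable_toD (a : R) f g :
  integrable_to a f -> integrable_to a g -> integrable_to a (f \+ g).
Proof.
by move=> fi gi; apply: eq_integrable (integrableD _ fi gi) => //.
Qed.

Lemma integrable_to_continuous (a : R) F :
  {within `[0, a], continuous F} -> integrable_to a F.
Proof.
by move=> cF; apply: continuous_compact_integrable => //; exact: segment_compact.
Qed.

Lemma is_primM (a : R) f F g G : 0 <= a -> is_prim a f F -> is_prim a g G ->
  is_prim a (fun t => f t * G t + F t * g t) (fun t => F t * G t).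
Proof.
move=> a0 fF gG.
have cF := is_prim_continuous a0 fF.
have cG := is_prim_continuous a0 gG.
move: fF gG => [fi FE] [gi GE].
have fGi := integrable_toM cG fi.
have gFi := integrable_toM cF gi.
have Fgi : integrable_to a (fun t => F t * g t).
  by under eq_fun do rewrite mulrC.
split; first exact: integrable_toD.
move=> x xa; have [x0 xa'] := andP xa.
have sub h : integrable_to a h -> integrable_to x h by exact: integrable_to_sub.
have ci c h : integrable_to x h -> integrable_to x (fun t => h t * c).
  move=> hi; apply: integrable_toM hi.
  by move=> z; exact: cvg_cst.
have := fubini_triangle x0 (sub _ fi) (sub _ gi).
have -> : \int[mu]_(t in `[0, x]) (g t * \int[mu]_(s in `[0, t]) f s) =
    \int[mu]_(t in `[0, x]) (F t * g t - g t * F 0).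
  apply: eq_Rintegral => t; rewrite inE/= in_itv/= => /andP[t0 tx].
  by rewrite (FE t) ?t0 ?(le_trans tx)//; ring.
have -> : \int[mu]_(s in `[0, x]) (f s * \int[mu]_(t in `[s, x]) g t) =
    \int[mu]_(t in `[0, x]) (f t * G x - f t * G t).
  apply: eq_Rintegral => t; rewrite inE/= in_itv/= => /andP[t0 tx].
  rewrite (GE t) ?t0 ?(le_trans tx)// (GE x)//.
  have := @Rintegral_itvB R g (BLeft 0) (BRight x) t (sub _ gi).
  rewrite !bnd_simp Rintegral_itv_obnd_cbnd; last first.
    by apply: integrableS (sub _ gi) => //; apply: subset_itvr; rewrite bnd_simp.
  by move=> <-//; ring.
rewrite !RintegralB//; try by [exact: sub|exact/ci/sub].
rewrite !RintegralZr//; try exact: sub.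
rewrite RintegralD//; try exact: sub.
have -> : \int[mu]_(t in `[0, x]) f t = F x - F 0.
  by rewrite (FE x)// addrC addKr.
have -> : \int[mu]_(t in `[0, x]) g t = G x - G 0.
  by rewrite (GE x)// addrC addKr.
by move=> E; lra.
Qed.

End Primitives.

(** * Reflection of an interval *)

Definition reflection {R : realType} (c : R) (x : measurableTypeR R) :
  measurableTypeR R := c - x.

Section Reflection.
Context {R : realType}.
Notation mu := (@lebesgue_measure R).
Implicit Types (a c : R).

Lemma measurable_reflection c : measurable_fun setT (reflection c).
Proof. by apply: measurable_funB => //; exact: measurable_cst. Qed.

HB.instance Definition _ c :=
  isMeasurableFun.Build _ _ _ _ (reflection c) (measurable_reflection c).

Lemma lebesgue_measure_reflection c (A : set R) : measurable A ->
  pushforward mu (reflection c) A = mu A.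
Proof.
move=> mA; apply/esym/lebesgue_measure_unique => //= _ [[u v]] _ <-.
have -> : pushforward mu (reflection c) [set` `]u, v]] = mu `[c - v, c - u[.
  congr (mu _); apply/seteqP; split => x; rewrite /= /reflection !in_itv/=; lra.
rewrite /= !lebesgue_measure_itv/= !lte_fin.
have -> : (c - v < c - u) = (u < v) by apply/idP/idP; lra.
by case: ifP => // _; congr EFin; rewrite /=; ring.
Qed.

Lemma ge0_integral_reflection c (D : set R) (f : R -> \bar R) :
  measurable D -> measurable_fun D f -> (forall x, D x -> 0 <= f x)%E ->
  (\int[mu]_(x in reflection c @^-1` D) f (c - x)%R = \int[mu]_(x in D) f x)%E.
Proof.
move=> mD mf f0.
rewrite -[LHS](@ge0_integral_pushforward _ _ _ _ _ _
  (measurable_reflection c) mu D f)//; last first.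
  by move=> x; rewrite inE; exact: f0.
by apply: eq_measure_integral => A mA _; exact: lebesgue_measure_reflection.
Qed.

Lemma integral_reflection c (D : set R) (f : R -> \bar R) :
  measurable D -> measurable_fun D f ->
  (\int[mu]_(x in reflection c @^-1` D) f (c - x)%R = \int[mu]_(x in D) f x)%E.
Proof.
move=> mD mf; rewrite integralE [RHS]integralE.
rewrite -(@ge0_integral_reflection c D f^\+%E)//; last exact: measurable_funepos.
rewrite -(@ge0_integral_reflection c D f^\-%E)//; last exact: measurable_funeneg.
by congr (_ - _)%E; apply: eq_integral => x _; rewrite ?funeposE ?funenegE.
Qed.

Lemma reflection_itvcc c u v :
  reflection c @^-1` `[u, v] = [set` `[c - v, c - u]].
Proof. by apply/seteqP; split => x; rewrite /= /reflection !in_itv/=; lra. Qed.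

Lemma integrable_to_reflection a f : integrable_to a f ->
  integrable_to a (fun x => f (a - x)).
Proof.
move=> /integrableP[mf fy]; apply/integrableP; split.
  apply/measurable_EFinP; apply: (@measurable_comp _ _ _ _ _ _ `[0, a]) => //.
  - by move=> _ [x /= + <-]; rewrite !in_itv/=; lra.
  - exact/measurable_EFinP.
  - by apply: measurable_funS (measurable_reflection a).
rewrite -(@integral_reflection a) in fy => //; last exact: measurableT_comp.
by rewrite reflection_itvcc subrr subr0 in fy.
Qed.

Lemma is_prim_reflection a f F : is_prim a f F ->
  is_prim a (fun t => - f (a - t)) (fun t => F (a - t)).
Proof.
move=> [fi FE]; have fai := integrable_to_reflection fi; split.
  exact: (integrableN fai).
move=> x xa; have [x0 xa'] := andP xa.
have xa2 : 0 <= a - x <= a by lra.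
have aa : 0 <= a <= a by lra.
have xi := integrable_to_sub xa fai.
have -> : \int[mu]_(t in `[0, x]) - f (a - t) =
    - \int[mu]_(t in `[0, x]) f (a - t).
  under eq_Rintegral do rewrite -mulN1r.
  by rewrite RintegralZl// mulN1r.
have -> : \int[mu]_(t in `[0, x]) f (a - t) = \int[mu]_(t in `[a - x, a]) f t.
  rewrite /Rintegral -(@integral_reflection a `[a - x, a] (EFin \o f))//; last first.
    move/integrableP : fi => [mf _]; apply: measurable_funS mf => //.
    by apply: subset_itvr; rewrite bnd_simp; lra.
  by rewrite reflection_itvcc subrr subKr.
rewrite (FE (a - x))// subr0 (FE a)//.
have := @Rintegral_itvB R f (BLeft 0) (BRight a) (a - x) fi.
rewrite !bnd_simp Rintegral_itv_obnd_cbnd; last first.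
  by apply: integrableS fi => //; apply: subset_itvr; rewrite bnd_simp; lra.
by move=> <-; lra.
Qed.

Lemma ae_reflection c (P : R -> Prop) :
  {ae mu, forall x, P x} -> {ae mu, forall x, P (c - x)}.
Proof.
move=> [N [mN N0 PN]]; exists (reflection c @^-1` N); split.
- rewrite -(setTI (_ @^-1` _)); exact: measurable_reflection.
- by rewrite -[LHS]/(pushforward mu (reflection c) N) lebesgue_measure_reflection.
- by move=> x /= nP; apply: PN.
Qed.

Lemma L2_real_reflection a f : L2_real a f -> L2_real a (fun x => f (a - x)).
Proof.
rewrite /L2_real; set g := f \_ `]0, a[.
have -> : (fun x => f (a - x)) \_ `]0, a[ = g \o reflection a.
  apply/funext => x; rewrite /g /= !patchE; congr (if _ then _ else _).
  by apply/idP/idP; rewrite !inE/= /reflection !in_itv/=; lra.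
rewrite inE => /andP[/[!inE]/= mg gfin].
apply/andP; split; rewrite inE/=.
  exact: measurableT_comp mg (measurable_reflection a).
move: gfin; rewrite /finite_norm unlock /=.
rewrite -(@ge0_integral_reflection a setT)//.
  apply/measurable_EFinP.
  apply/(@measurableT_comp _ _ _ _ _ _ (fun x : R => x `^ 2)%R) => //.
  exact: measurableT_comp.
Qed.

End Reflection.

Section Uniqueness.
Context {R : realType}.
Notation mu := (@lebesgue_measure R).
Implicit Types (a : R).

Lemma continuous_primitive_eq0 a (h : R -> R) : 0 < a ->
  {within `[0, a], continuous h} ->
  (forall x, 0 <= x <= a -> \int[mu]_(t in `[0, x]) h t = 0) ->
  forall x, 0 <= x <= a -> h x = 0.
Proof.
move=> a0 ch h0.
have hi := integrable_to_continuous ch.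
have /(continuous_within_itvP _ a0)[cin c0 ca] := ch.
have hin x : 0 < x < a -> h x = 0.
  move=> /andP[x0 xa].
  have xin : x \in `]0, a[ by rewrite in_itv/= x0 xa.
  have [_ <-] := continuous_FTC1_closed xa hi x0 (cin x xin).
  rewrite derive1E (@near_eq_derive _ _ _ _ (cst 0)) ?derive_cst//.
  near=> y; apply: h0; apply/andP; split; apply: ltW; near: y.
  - exact: lt_nbhsr.
  - exact: lt_nbhsl.
have e0 : h 0 = 0.
  rewrite -(cvg_lim (@Rhausdorff R) c0).
  apply: lim_near_cst; first exact: Rhausdorff.
  near=> y; apply: hin; apply/andP; split; near: y.
  - exact: nbhs_right_gt.
  - exact: nbhs_right_lt.
have ea : h a = 0.
  rewrite -(cvg_lim (@Rhausdorff R) ca).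
  apply: lim_near_cst; first exact: Rhausdorff.
  near=> y; apply: hin; apply/andP; split; near: y.
  - exact: nbhs_left_gt.
  - exact: nbhs_left_lt.
move=> x /andP[]; rewrite le_eqVlt => /predU1P[<-//|x0].
by rewrite le_eqVlt => /predU1P[->//|xa]; apply: hin; rewrite x0.
Unshelve. all: by end_near. Qed.

Lemma is_prim_unique a f F g G : 0 < a ->
  is_prim a f F -> is_prim a g G ->
  (forall x, 0 <= x <= a -> F x = G x) ->
  {within `[0, a], continuous f} -> {within `[0, a], continuous g} ->
  forall x, 0 <= x <= a -> f x = g x.
Proof.
move=> a0 fF gG FG cf cg x xa; apply/eqP; rewrite -subr_eq0; apply/eqP.
apply: (@continuous_primitive_eq0 a (f \- g)) xa => //.
  exact: (within_continuousB cf cg).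
move=> z za; have [_ /(_ z za)/=] := is_primB fF gG.
have aa : (0 : R) <= 0 <= a by rewrite lexx ltW.
by rewrite !FG// !subrr add0r.
Qed.

End Uniqueness.

Section ComplexPrimitives.
Context {R : realType}.
Notation mu := (@lebesgue_measure R).
Implicit Types (a : R) (f g F G : R -> R[i]).

Definition Cprim a f F : Prop :=
  is_prim a (fun x => complex.Re (f x)) (fun x => complex.Re (F x)) /\
  is_prim a (fun x => complex.Im (f x)) (fun x => complex.Im (F x)).

Lemma ReD (x y : R[i]) : complex.Re (x + y) = complex.Re x + complex.Re y.
Proof. by case: x y => [? ?] []. Qed.
Lemma ImD (x y : R[i]) : complex.Im (x + y) = complex.Im x + complex.Im y.
Proof. by case: x y => [? ?] []. Qed.
Lemma ReN (x : R[i]) : complex.Re (- x) = - complex.Re x.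
Proof. by case: x. Qed.
Lemma ImN (x : R[i]) : complex.Im (- x) = - complex.Im x.
Proof. by case: x. Qed.
Lemma ReM (x y : R[i]) : complex.Re (x * y) =
  complex.Re x * complex.Re y - complex.Im x * complex.Im y.
Proof. by case: x y => [? ?] []. Qed.
Lemma ImM (x y : R[i]) : complex.Im (x * y) =
  complex.Re x * complex.Im y + complex.Im x * complex.Re y.
Proof. by case: x y => [? ?] []. Qed.
Lemma complex_ext (x y : R[i]) : complex.Re x = complex.Re y ->
  complex.Im x = complex.Im y -> x = y.
Proof. by case: x y => [? ?] [? ?] /= -> ->. Qed.

Definition ReImE := (ReD, ImD, ReN, ImN, ReM, ImM).

Lemma is_prim_eq a (f f' F F' : R -> R) : f =1 f' -> F =1 F' ->
  is_prim a f F -> is_prim a f' F'.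
Proof. by move=> /funext -> /funext ->. Qed.

Lemma CprimD a f F g G : Cprim a f F -> Cprim a g G ->
  Cprim a (fun x => f x + g x) (fun x => F x + G x).
Proof.
move=> [fr fi] [gr gi]; split.
  by apply: is_prim_eq (is_primD fr gr) => x /=; rewrite !ReImE.
by apply: is_prim_eq (is_primD fi gi) => x /=; rewrite !ReImE.
Qed.

Lemma CprimZ a c f F : Cprim a f F ->
  Cprim a (fun x => c * f x) (fun x => c * F x).
Proof.
move=> [fr fi]; split.
  by apply: is_prim_eq (is_primB (is_primZ (complex.Re c) fr)
    (is_primZ (complex.Im c) fi)) => x /=; rewrite !ReImE.
by apply: is_prim_eq (is_primD (is_primZ (complex.Re c) fi)
  (is_primZ (complex.Im c) fr)) => x /=; rewrite !ReImE.
Qed.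

Lemma CprimM a f F g G : 0 <= a -> Cprim a f F -> Cprim a g G ->
  Cprim a (fun x => f x * G x + F x * g x) (fun x => F x * G x).
Proof.
move=> a0 [fr fi] [gr gi]; split.
  by apply: is_prim_eq (is_primB (is_primM a0 fr gr) (is_primM a0 fi gi)) => x /=;
    rewrite !ReImE; ring.
by apply: is_prim_eq (is_primD (is_primM a0 fr gi) (is_primM a0 fi gr)) => x /=;
  rewrite !ReImE; ring.
Qed.

Lemma Cprim_reflection a f F : Cprim a f F ->
  Cprim a (fun t => - f (a - t)) (fun t => F (a - t)).
Proof.
move=> [fr fi]; split.
  by apply: is_prim_eq (is_prim_reflection fr) => x /=; rewrite ?ReImE.
by apply: is_prim_eq (is_prim_reflection fi) => x /=; rewrite ?ReImE.
Qed.

Lemma Cprim_ae0 a f F : Cprim a f F ->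
  {ae mu, forall x, 0 < x < a -> f x = 0} ->
  forall x, 0 <= x <= a -> F x = F 0.
Proof.
move=> [fr fi] f0 x xa.
have filt := ae_filter_ringOfSetsType mu.
apply: complex_ext.
- apply: (is_prim_ae0 fr) xa.
  by move: f0; apply: filterS => y /= f0 ya; rewrite f0.
- apply: (is_prim_ae0 fi) xa.
  by move: f0; apply: filterS => y /= f0 ya; rewrite f0.
Qed.

Lemma H2P a y dy ddy : 0 <= a ->
  H2 a y dy ddy <-> [/\ L2_complex a ddy, Cprim a dy y & Cprim a ddy dy].
Proof.
move=> a0; split=> [[L2 p1 p2]|[L2 [p1 p1'] [p2 p2']]]; last first.
  have [_ q1] := p1; have [_ q1'] := p1'; have [_ q2] := p2; have [_ q2'] := p2'.
  by split=> // x xa; apply: complex_ext; rewrite ReImE/=; auto.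
have dP : Cprim a ddy dy.
  split; split.
  - exact: L2_integrable_to L2.1.
  - by move=> x xa; rewrite p2// ReImE.
  - exact: L2_integrable_to L2.2.
  - by move=> x xa; rewrite p2// ReImE.
split=> //; split; split.
- exact/integrable_to_continuous/(is_prim_continuous a0 dP.1).
- by move=> x xa; rewrite p1// ReImE.
- exact/integrable_to_continuous/(is_prim_continuous a0 dP.2).
- by move=> x xa; rewrite p1// ReImE.
Qed.

Lemma H2_unique a y dy ddy z dz ddz : 0 < a -> H2 a y dy ddy -> H2 a z dz ddz ->
  (forall x, 0 <= x <= a -> y x = z x) -> forall x, 0 <= x <= a -> dy x = dz x.
Proof.
move=> a0 /(H2P _ _ _ (ltW a0))[_ [p1 p1'] [p2 p2']].
move=> /(H2P _ _ _ (ltW a0))[_ [q1 q1'] [q2 q2']] yz x xa; apply: complex_ext.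
- apply: (is_prim_unique a0 p1 q1) xa => [u ua||]; first by rewrite yz.
  + exact: is_prim_continuous (ltW a0) p2.
  + exact: is_prim_continuous (ltW a0) q2.
- apply: (is_prim_unique a0 p1' q1') xa => [u ua||]; first by rewrite yz.
  + exact: is_prim_continuous (ltW a0) p2'.
  + exact: is_prim_continuous (ltW a0) q2'.
Qed.

Lemma L2_real_comb a (c d : R) (f g : R -> R) : L2_real a f -> L2_real a g ->
  L2_real a (fun x => c * f x + d * g x).
Proof.
rewrite /L2_real => fl gl.
have -> : (fun x => c * f x + d * g x) \_ `]0, a[ =
    c *: (f \_ `]0, a[) + d *: (g \_ `]0, a[).
  apply/funext => x; rewrite /= !fctE/= !patchE; case: ifP => // _.
  by rewrite -[point]/(0 : R) !scaler0 addr0.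
have [L0 Llin] := @Lfun_submod_closed _ _ R mu 2%:E (lee1n 2).
by rewrite -[X in _ + X]addr0; apply: (Llin c _ _ fl); apply: Llin.
Qed.

Lemma L2_complex_comb a (c d : R[i]) f g : L2_complex a f -> L2_complex a g ->
  L2_complex a (fun x => c * f x + d * g x).
Proof.
move=> [fr fi] [gr gi]; split.
- have := L2_real_comb 1 1 (L2_real_comb (complex.Re c) (- complex.Im c) fr fi)
    (L2_real_comb (complex.Re d) (- complex.Im d) gr gi).
  by congr L2_real; apply/funext => x; rewrite !ReImE; ring.
- have := L2_real_comb 1 1 (L2_real_comb (complex.Re c) (complex.Im c) fi fr)
    (L2_real_comb (complex.Re d) (complex.Im d) gi gr).
  by congr L2_real; apply/funext => x; rewrite !ReImE; ring.
Qed.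

Lemma H2_comb a (c d : R[i]) y dy ddy z dz ddz : 0 <= a ->
  H2 a y dy ddy -> H2 a z dz ddz ->
  H2 a (fun x => c * y x + d * z x) (fun x => c * dy x + d * dz x)
    (fun x => c * ddy x + d * ddz x).
Proof.
move=> a0 /(H2P _ _ _ a0)[L p1 p2] /(H2P _ _ _ a0)[L' q1 q2].
apply/(H2P _ _ _ a0); split; first exact: L2_complex_comb.
- by apply: CprimD; exact: CprimZ.
- by apply: CprimD; exact: CprimZ.
Qed.

Lemma H2_reflection a y dy ddy : 0 <= a -> H2 a y dy ddy ->
  H2 a (fun x => y (a - x)) (fun x => - dy (a - x)) (fun x => ddy (a - x)).
Proof.
move=> a0 /(H2P _ _ _ a0)[L p1 p2]; apply/(H2P _ _ _ a0); split.
- by split; [exact: L2_real_reflection L.1|exact: L2_real_reflection L.2].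
- exact: Cprim_reflection.
- have := CprimZ (-1) (Cprim_reflection p2).
  by congr Cprim; apply/funext => x; rewrite mulN1r ?opprK.
Qed.

End ComplexPrimitives.

(** * Solutions of the differential equation *)

Section ODE.
Context {R : realType}.
Notation mu := (@lebesgue_measure R).
Implicit Types (a : R) (lam : R[i]) (y z : R -> R[i]).

Lemma wronskian_cst a (q : R -> R) lam y dy z dz : 0 <= a ->
  ode_solution a q lam y dy -> ode_solution a q lam z dz ->
  forall x, 0 <= x <= a ->
    y x * dz x - dy x * z x = y 0 * dz 0 - dy 0 * z 0.
Proof.
move=> a0 [ddy [/(H2P _ _ _ a0)[_ y1 y2] ey]].
move=> [ddz [/(H2P _ _ _ a0)[_ z1 z2] ez]] x xa.
have W := CprimD (CprimM a0 y1 z2) (CprimZ (-1) (CprimM a0 y2 z1)).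
rewrite -(mulN1r (dy x * z x)) -(mulN1r (dy 0 * z 0)); apply: (Cprim_ae0 W) xa.
have F := ae_filter_ringOfSetsType mu.
move: ey ez; apply: filterS2 => t /= yt zt ta.
have {yt} -> : ddy t = (q t)%:C * y t - lam * y t by rewrite -yt//; ring.
have {zt} -> : ddz t = (q t)%:C * z t - lam * z t by rewrite -zt//; ring.
by ring.
Qed.

Section FundamentalSystem.
Context (a : R) (q : R -> R) (lam : R[i]) (a0 : 0 <= a).
Context (C dC S dS : R -> R[i]).
Hypothesis C_sol : ode_solution a q lam C dC.
Hypothesis C_init : C 0 = 1 /\ dC 0 = 0.
Hypothesis S_sol : ode_solution a q lam S dS.
Hypothesis S_init : S 0 = 0 /\ dS 0 = 1.

Lemma wronskianCS x : 0 <= x <= a -> C x * dS x - dC x * S x = 1.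
Proof.
move=> xa; rewrite (wronskian_cst a0 C_sol S_sol xa).
have [-> ->] := C_init; have [-> ->] := S_init.
by rewrite mul1r mul0r subr0.
Qed.

Lemma ode_solutionE y dy : ode_solution a q lam y dy ->
  forall x, 0 <= x <= a ->
    y x = y 0 * C x + dy 0 * S x /\ dy x = y 0 * dC x + dy 0 * dS x.
Proof.
move=> ysol x xa.
have := wronskian_cst a0 ysol S_sol xa; have := wronskian_cst a0 ysol C_sol xa.
have [-> ->] := C_init; have [-> ->] := S_init.
rewrite !mulr0 !mulr1 subr0 sub0r => WC WS.
have W := wronskianCS xa.
have -> : dy 0 = C x * dy x - y x * dC x by rewrite -[dy 0]opprK -WC; ring.
rewrite -WS; split.
  rewrite -[LHS]mul1r -W; ring.
rewrite -[LHS]mul1r -W; ring.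
Qed.

Lemma ode_solution_comb c d : ode_solution a q lam
  (fun x => c * C x + d * S x) (fun x => c * dC x + d * dS x).
Proof.
have [ddC [HC eC]] := C_sol; have [ddS [HS eS]] := S_sol.
exists (fun x => c * ddC x + d * ddS x); split; first exact: H2_comb.
have F := ae_filter_ringOfSetsType mu.
move: eC eS; apply: filterS2 => t /= Ct St ta.
have {}Ct : ddC t = (q t)%:C * C t - lam * C t by rewrite -Ct//; ring.
have {}St : ddS t = (q t)%:C * S t - lam * S t by rewrite -St//; ring.
by rewrite Ct St; ring.
Qed.

End FundamentalSystem.
End ODE.

(** * The linear system at the vertices *)

Section Determinant.
Variable F : comNzRingType.

(* The iterated Laplace expansion along the first row computes by reduction, so
   that the determinant of an explicit matrix is within reach of [ring]. *)
Fixpoint laplace (n : nat) (f : nat -> nat -> F) : F :=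
  if n is n'.+1 then
    foldr +%R 0
      [seq f 0%N j * ((-1) ^+ j * laplace n' (fun i k => f i.+1 (bump j k)))
      | j <- iota 0 n]
  else 1.

Lemma det_laplace n (f : nat -> nat -> F) :
  \det (\matrix_(i < n, j < n) f i j) = laplace n f.
Proof.
elim: n f => [|n IHn] f; first by rewrite det_mx00.
rewrite (expand_det_row _ ord0) [RHS]/laplace -/laplace foldrE big_map.
rewrite -[in RHS](subn0 n.+1) -/(index_iota 0 n.+1) big_mkord.
apply: eq_bigr => j _; rewrite mxE; congr (_ * (_ * _)).
by rewrite -IHn; congr (\det _); apply/matrixP => i k; rewrite !mxE.
Qed.

End Determinant.

Section Dispersion.
Variable F : fieldType.
Variables c1 c2 c3 c4 s1 s2 s3 s4 c1' c2' c3' c4' s1' s2' s3' s4' : F.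
Variables w1 w2 w3 w4 v1 v2 v3 v4 : F.
Hypothesis wv1 : w1 * v1 = 1.
Hypothesis wv2 : w2 * v2 = 1.
Hypothesis wv3 : w3 * v3 = 1.
Hypothesis wv4 : w4 * v4 = 1.
Hypothesis W1 : c1 * s1' - c1' * s1 = 1.
Hypothesis W2 : c2 * s2' - c2' * s2 = 1.
Hypothesis W3 : c3 * s3' - c3' * s3 = 1.
Hypothesis W4 : c4 * s4' - c4' * s4 = 1.

(* The six columns are the equations [w_j y_j(a_j) = E] (divided by [w_j]),
   [sum_j B_j = 0] and [sum_j w_j y_j'(a_j) = 0]; the six rows are the unknowns
   [B_1, ..., B_4, A, E], where [y_j = A C_j + B_j S_j]. *)
Definition vertex_rows : seq (seq F) :=
  [:: [:: s1; 0; 0; 0; 1; w1 * s1'];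
      [:: 0; s2; 0; 0; 1; w2 * s2'];
      [:: 0; 0; s3; 0; 1; w3 * s3'];
      [:: 0; 0; 0; s4; 1; w4 * s4'];
      [:: c1; c2; c3; c4; 0; w1 * c1' + w2 * c2' + w3 * c3' + w4 * c4'];
      [:: - v1; - v2; - v3; - v4; 0; 0]].

Definition vertex_matrix : 'M[F]_6 :=
  \matrix_(i < 6, j < 6) (nth [::] vertex_rows i)`_j.

Definition dispersion_lhs : F :=
  (c1' * s2 * s3 * s4 + c1 * s2' * s3 * s4 +
    c1 * s2 * s3' * s4 + c1 * s2 * s3 * s4') +
  (s1' * c2 * s3 * s4 + s1 * c2' * s3 * s4 +
    s1 * c2 * s3' * s4 + s1 * c2 * s3 * s4') +
  (s1' * s2 * c3 * s4 + s1 * s2' * c3 * s4 +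
    s1 * s2 * c3' * s4 + s1 * s2 * c3 * s4') +
  (s1' * s2 * s3 * c4 + s1 * s2' * s3 * c4 +
    s1 * s2 * s3' * c4 + s1 * s2 * s3 * c4').

Definition dispersion_rhs : F :=
  (w1 * v2 + w2 * v1) * (s3 * s4) + (w1 * v3 + w3 * v1) * (s2 * s4) +
  (w1 * v4 + w4 * v1) * (s2 * s3) + (w2 * v3 + w3 * v2) * (s1 * s4) +
  (w2 * v4 + w4 * v2) * (s1 * s3) + (w3 * v4 + w4 * v3) * (s1 * s2).

Lemma det_vertex_matrix : \det vertex_matrix = dispersion_rhs - dispersion_lhs.
Proof.
rewrite (det_laplace 6 (fun i j => (nth [::] vertex_rows i)`_j)) /laplace /=.
transitivity
 ((v1 * w2 * (c2 * s2' - c2' * s2) * (s3 * s4) +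
   v1 * w3 * (c3 * s3' - c3' * s3) * (s2 * s4) +
   v1 * w4 * (c4 * s4' - c4' * s4) * (s2 * s3) +
   v2 * w1 * (c1 * s1' - c1' * s1) * (s3 * s4) +
   v2 * w3 * (c3 * s3' - c3' * s3) * (s1 * s4) +
   v2 * w4 * (c4 * s4' - c4' * s4) * (s1 * s3) +
   v3 * w1 * (c1 * s1' - c1' * s1) * (s2 * s4) +
   v3 * w2 * (c2 * s2' - c2' * s2) * (s1 * s4) +
   v3 * w4 * (c4 * s4' - c4' * s4) * (s1 * s2) +
   v4 * w1 * (c1 * s1' - c1' * s1) * (s2 * s3) +
   v4 * w2 * (c2 * s2' - c2' * s2) * (s1 * s3) +
   v4 * w3 * (c3 * s3' - c3' * s3) * (s1 * s2)) -
  ((w1 * v1) * (c1' * s2 * s3 * s4 + c2 * s1' * (s3 * s4) +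
     c3 * s1' * (s2 * s4) + c4 * s1' * (s2 * s3)) +
   (w2 * v2) * (c2' * s1 * s3 * s4 + c1 * s2' * (s3 * s4) +
     c3 * s2' * (s1 * s4) + c4 * s2' * (s1 * s3)) +
   (w3 * v3) * (c3' * s1 * s2 * s4 + c1 * s3' * (s2 * s4) +
     c2 * s3' * (s1 * s4) + c4 * s3' * (s1 * s2)) +
   (w4 * v4) * (c4' * s1 * s2 * s3 + c1 * s4' * (s2 * s3) +
     c2 * s4' * (s1 * s3) + c3 * s4' * (s1 * s2)))); last first.
  by rewrite wv1 wv2 wv3 wv4 W1 W2 W3 W4 /dispersion_lhs /dispersion_rhs; ring.
ring.
Qed.

Lemma mul_vertex_matrix_eq0 (u : 'rV[F]_6) (e : nat -> F) :
  (forall i : 'I_6, u 0 i = e i) ->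
  u *m vertex_matrix = 0 <->
  [/\ e 0%N + e 1%N + e 2%N + e 3%N = 0,
      [/\ e 4%N * c1 + e 0%N * s1 = e 5%N * v1,
          e 4%N * c2 + e 1%N * s2 = e 5%N * v2,
          e 4%N * c3 + e 2%N * s3 = e 5%N * v3 &
          e 4%N * c4 + e 3%N * s4 = e 5%N * v4] &
      w1 * (e 4%N * c1' + e 0%N * s1') + w2 * (e 4%N * c2' + e 1%N * s2')
      + w3 * (e 4%N * c3' + e 2%N * s3') + w4 * (e 4%N * c4' + e 3%N * s4') = 0].
Proof.
move=> ue; have E (j : 'I_6) : (u *m vertex_matrix) 0 j =
    e 0%N * (nth [::] vertex_rows 0)`_j + e 1%N * (nth [::] vertex_rows 1)`_j
    + e 2%N * (nth [::] vertex_rows 2)`_j + e 3%N * (nth [::] vertex_rows 3)`_j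
    + e 4%N * (nth [::] vertex_rows 4)`_j + e 5%N * (nth [::] vertex_rows 5)`_j.
  rewrite /vertex_matrix mxE; under eq_bigr do rewrite mxE ue.
  by rewrite !big_ord_recl big_ord0 /= !addrA addr0.
split=> [uM|[e1 [e2 e3 e4 e5] e6]].
- have {}E (j : 'I_6) := etrans (esym (E j)) (congr1 (fun m : 'rV_6 => m 0 j) uM).
  have E0 := E (@Ordinal 6 0 isT); have E1 := E (@Ordinal 6 1 isT).
  have E2 := E (@Ordinal 6 2 isT); have E3 := E (@Ordinal 6 3 isT).
  have E4 := E (@Ordinal 6 4 isT); have E5 := E (@Ordinal 6 5 isT).
  rewrite !mxE /= in E0 E1 E2 E3 E4 E5.
  split; first by rewrite -[RHS]E4; ring.
  + by split; apply/eqP; rewrite -subr_eq0; apply/eqP;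
      [rewrite -[RHS]E0|rewrite -[RHS]E1|rewrite -[RHS]E2|rewrite -[RHS]E3]; ring.
  + by rewrite -[RHS]E5; ring.
- apply/rowP => j; rewrite E mxE.
  case: j => [[|[|[|[|[|[|//]]]]]] ?] /=.
  + apply: etrans (_ : (e 4%N * c1 + e 0%N * s1) - e 5%N * v1 = 0); first ring.
    by rewrite e2 subrr.
  + apply: etrans (_ : (e 4%N * c2 + e 1%N * s2) - e 5%N * v2 = 0); first ring.
    by rewrite e3 subrr.
  + apply: etrans (_ : (e 4%N * c3 + e 2%N * s3) - e 5%N * v3 = 0); first ring.
    by rewrite e4 subrr.
  + apply: etrans (_ : (e 4%N * c4 + e 3%N * s4) - e 5%N * v4 = 0); first ring.
    by rewrite e5 subrr.
  + by rewrite -[RHS]e1; ring.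
  + by rewrite -[RHS]e6; ring.
Qed.

Lemma vertex_system_solvable :
  (exists A B1 B2 B3 B4 E : F,
    [/\ ~~ [&& A == 0, B1 == 0, B2 == 0, B3 == 0 & B4 == 0],
        B1 + B2 + B3 + B4 = 0,
        [/\ w1 * (A * c1 + B1 * s1) = E, w2 * (A * c2 + B2 * s2) = E,
            w3 * (A * c3 + B3 * s3) = E & w4 * (A * c4 + B4 * s4) = E] &
        w1 * (A * c1' + B1 * s1') + w2 * (A * c2' + B2 * s2')
        + w3 * (A * c3' + B3 * s3') + w4 * (A * c4' + B4 * s4') = 0]) <->
  dispersion_lhs = dispersion_rhs.
Proof.
have wvE (w v x E : F) : w * v = 1 -> (w * x = E <-> x = E * v).
  move=> wv; split=> [<-|->]; first by rewrite [RHS]mulrAC wv mul1r.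
  by rewrite mulrCA wv mulr1.
split.
- move=> [A [B1 [B2 [B3 [B4 [E [nz H1 [Ha Hb Hc Hd] H3]]]]]]].
  have : \det vertex_matrix == 0.
    pose e := nth 0 [:: B1; B2; B3; B4; A; E].
    apply/det0P; exists (\row_i e i).
      apply: contraNneq nz => u0.
      have {}u0 (i : 'I_6) : e i = 0.
        by have := congr1 (fun m : 'rV_6 => m 0 i) u0; rewrite !mxE.
      have := u0 (@Ordinal 6 0 isT); have := u0 (@Ordinal 6 1 isT).
      have := u0 (@Ordinal 6 2 isT); have := u0 (@Ordinal 6 3 isT).
      have := u0 (@Ordinal 6 4 isT); rewrite /e /= => -> -> -> -> ->.
      by rewrite eqxx.
    apply/(@mul_vertex_matrix_eq0 _ e) => [i|]; first by rewrite mxE.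
    by split=> //; split; [exact/(wvE _ _ _ _ wv1)|exact/(wvE _ _ _ _ wv2)|
      exact/(wvE _ _ _ _ wv3)|exact/(wvE _ _ _ _ wv4)].
  by rewrite det_vertex_matrix subr_eq0 => /eqP.
- move=> LR; have /det0P[u u0] : \det vertex_matrix == 0.
    by rewrite det_vertex_matrix LR subrr.
  pose e n := u 0 (inord n).
  move/(@mul_vertex_matrix_eq0 _ e) => [|H1 [Ha Hb Hc Hd] H3].
    by move=> i; rewrite /e inord_val.
  exists (e 4%N), (e 0%N), (e 1%N), (e 2%N), (e 3%N), (e 5%N).
  split=> //; last first.
    by split; [exact/(wvE _ _ _ _ wv1)|exact/(wvE _ _ _ _ wv2)|
      exact/(wvE _ _ _ _ wv3)|exact/(wvE _ _ _ _ wv4)].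
  apply: contraNN u0 => /and5P[/eqP e4 /eqP e0 /eqP e1 /eqP e2 /eqP e3].
  have e5 : e 5%N = 0.
    move/(wvE _ _ _ _ wv1): Ha => <-.
    by rewrite e4 e0 !mul0r addr0 mulr0.
  apply/eqP/rowP => i; rewrite mxE -(inord_val i).
  by case: i => [[|[|[|[|[|[|//]]]]]] ?].
Qed.

End Dispersion.

(** * Functions on the graph *)

Section Cis.
Context {R : realType}.
Implicit Types s t : R.

Lemma cis0 : cis (0 : R) = 1.
Proof. by rewrite /cis cos0 sin0. Qed.

Lemma cisD s t : cis (s + t) = cis s * cis t.
Proof.
by rewrite /cis cosD sinD; apply: complex_ext; rewrite ReImE /=; ring.
Qed.

Lemma cisK t : cis t * cis (- t) = 1.
Proof. by rewrite -cisD subrr cis0. Qed.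

Lemma cisDN t : cis t + cis (- t) = 2 * (cos t)%:C.
Proof.
by rewrite /cis cosN sinN; apply: complex_ext; rewrite !ReImE /=; ring.
Qed.

End Cis.

Section Grid.

Definition even_vertex (v : int * int) : bool := (2 %| v.1 + v.2)%Z.

(* The edges leaving the vertex (1, 0) are the translates of the edges [k] of W
   by [shift k]: see [step_opposite_shift]. *)
Definition shift (k : edge) : int * int :=
  match k with e1 => (0, 0) | e2 => (0, 1) | e3 => (1, 0) | e4 => (1, 1) end.

Lemma opposite_opposite k : opposite (opposite k) = k.
Proof. by case: k. Qed.

Lemma edge_length_opposite (R : realType) (a1 a2 : R) k :
  edge_length a1 a2 (opposite k) = edge_length a1 a2 k.
Proof. by case: k. Qed.

Lemma step_opposite v k : step (step v k) (opposite k) = v.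
Proof. by case: v k => [m n] [] /=; congr (_, _); lia. Qed.

Lemma step_translate v p k : step (translate v p) k = translate (step v k) p.
Proof.
by case: v p k => [m n] [p1 p2] []; rewrite /translate /=; congr (_, _); lia.
Qed.

Lemma even_vertex_step v k : even_vertex (step v k) = ~~ even_vertex v.
Proof. by case: v k => [m n] []; rewrite /even_vertex /=; lia. Qed.

Lemma even_vertex_translate v p : even_vertex (translate v p) = even_vertex v.
Proof.
by case: v p => [m n] [p1 p2]; rewrite /even_vertex /translate /=; lia.
Qed.

Lemma even_vertexP v : even_vertex v -> exists p, v = translate (0, 0) p.
Proof.
case: v => m n; rewrite /even_vertex /= => /dvdzP[r mn].
by exists (m - r, r); rewrite /translate /=; congr (_, _); lia.
Qed.

Lemma step_opposite_shift v k :
  step v (opposite k) = translate (step v e4) (shift k).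
Proof. by case: v k => [m n] []; rewrite /translate /=; congr (_, _); lia. Qed.

End Grid.

Section Eigenvalue.
Context {R : realType}.
Notation mu := (@lebesgue_measure R).
Variables (a1 a2 : R) (q : edge -> R -> R) (theta1 theta2 : R) (lam : R[i]).
Hypotheses (a1_gt0 : 0 < a1) (a2_gt0 : 0 < a2).
Notation len := (edge_length a1 a2).

Lemma edge_length_gt0 k : 0 < len k. Proof. by case: k. Qed.

Let len_ge0 k : 0 <= len k. Proof. exact/ltW/edge_length_gt0. Qed.

Definition angle (p : int * int) : R := p.1%:~R * theta1 + p.2%:~R * theta2.

Lemma H2Z a c (y dy ddy : R -> R[i]) : 0 <= a -> H2 a y dy ddy ->
  H2 a (fun x => c * y x) (fun x => c * dy x) (fun x => c * ddy x).
Proof.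
move=> a0 H; have := H2_comb c 0 a0 H H.
by congr H2; apply/funext => x; rewrite mul0r addr0.
Qed.

Section Restriction.
Variables y dy ddy : graph_function R.
Hypothesis y_fun : is_graph_function a1 a2 y.
Hypothesis y_fb : floquet_bloch a1 a2 theta1 theta2 y.
Hypothesis y_H2 : forall v j, H2 (len j) (y v j) (dy v j) (ddy v j).
Hypothesis y_neumann : forall v, neumann_at y dy v.

Lemma far_value k x : 0 <= x <= len k ->
  y (1, 0) (opposite k) x = cis (angle (shift k)) * y (0, 0) k (len k - x).
Proof.
move=> xk; rewrite y_fun edge_length_opposite// opposite_opposite.
rewrite step_opposite_shift y_fb//; last by move: xk; lra.
Qed.

Lemma far_derivative k :
  dy (1, 0) (opposite k) 0 = - (cis (angle (shift k)) * dy (0, 0) k (len k)).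
Proof.
have H := y_H2 (1, 0) (opposite k); rewrite edge_length_opposite in H.
have K := H2Z (cis (angle (shift k))) (len_ge0 k)
  (H2_reflection (len_ge0 k) (y_H2 (0, 0) k)).
rewrite (H2_unique (edge_length_gt0 k) H K) ?lexx ?len_ge0//.
  by rewrite subr0 mulrN.
exact: far_value.
Qed.

Lemma far_vertex_conditions :
  (forall i j, cis (angle (shift i)) * y (0, 0) i (len i) =
               cis (angle (shift j)) * y (0, 0) j (len j)) /\
  cis (angle (shift e1)) * dy (0, 0) e1 (len e1)
  + cis (angle (shift e2)) * dy (0, 0) e2 (len e2)
  + cis (angle (shift e3)) * dy (0, 0) e3 (len e3)
  + cis (angle (shift e4)) * dy (0, 0) e4 (len e4) = 0.
Proof.
have [cont kir] := y_neumann (1, 0); split=> [i j|].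
  have := cont (opposite i) (opposite j).
  by rewrite !far_value ?lexx ?len_ge0// !subr0.
move: kir; rewrite (far_derivative e4) (far_derivative e3).
rewrite (far_derivative e2) (far_derivative e1).
by move=> /(congr1 -%R); rewrite oppr0 => <-; ring.
Qed.

Lemma nonzero_on_W v j x : 0 <= x <= len j -> y v j x != 0 ->
  exists k t, 0 <= t <= len k /\ y (0, 0) k t != 0.
Proof.
have even u i t : even_vertex u -> 0 <= t <= len i -> y u i t != 0 ->
    exists k t, 0 <= t <= len k /\ y (0, 0) k t != 0.
  move=> /even_vertexP[p ->] ti; rewrite y_fb// mulf_eq0 negb_or => /andP[_ y0].
  by exists i, t.
move=> xj yx; have [ev|od] := boolP (even_vertex v); first exact: even yx.
apply: (even (step v j) (opposite j) (len j - x)).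
- by rewrite even_vertex_step.
- by rewrite edge_length_opposite; move: xj; lra.
- by rewrite -y_fun.
Qed.

End Restriction.
End Eigenvalue.

Section Extension.
Context {R : realType}.
Notation mu := (@lebesgue_measure R).
Variables (a1 a2 : R) (q : edge -> R -> R) (theta1 theta2 : R) (lam : R[i]).
Hypotheses (a1_gt0 : 0 < a1) (a2_gt0 : 0 < a2).
Notation len := (edge_length a1 a2).
Notation weight k := (cis (angle theta1 theta2 (shift k))).

Let len_ge0 k : 0 <= len k. Proof. exact/ltW/edge_length_gt0. Qed.

(* This is [e^{i (p1 theta1 + p2 theta2)}] at [v = p1 k1 + p2 k2]. *)
Definition phase (v : int * int) : R[i] :=
  cis ((v.1 - v.2)%:~R / 2 * theta1 + (v.1 + v.2)%:~R / 2 * theta2).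

Lemma phase0 : phase (0, 0) = 1.
Proof. by rewrite /phase /= !mul0r addr0 cis0. Qed.

Lemma phase_translate v p :
  phase (translate v p) = cis (angle theta1 theta2 p) * phase v.
Proof.
rewrite /phase -cisD /angle; congr cis.
case: v p => [m n] [p1 p2]; rewrite /translate /= !(intrD, rmorphN, rmorphB) /=.
by field.
Qed.

(* Extends functions on W to the graph: edges leaving an odd vertex are described
   from their other end, by [g], because derivatives change sign there. *)
Definition extend (f g : edge -> R -> R[i]) : graph_function R := fun v j x =>
  if even_vertex v then phase v * f j x
  else phase (step v j) * g (opposite j) (len j - x).

Lemma extend_translate f g v p j x :
  extend f g (translate v p) j x = cis (angle theta1 theta2 p) * extend f g v j x.
Proof.
rewrite /extend even_vertex_translate step_translate !phase_translate.
by case: ifP => _; rewrite mulrA.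
Qed.

Lemma is_graph_function_extend f : is_graph_function a1 a2 (extend f f).
Proof.
move=> v j x xj; rewrite /extend even_vertex_step step_opposite opposite_opposite.
by case: (even_vertex v) => //=; rewrite edge_length_opposite subKr.
Qed.

Variables y dy : edge -> R -> R[i].
Hypothesis y_sol : forall k, ode_solution (len k) (q k) lam (y k) (dy k).
Hypothesis y_cont : forall i j, y i 0 = y j 0.
Hypothesis y_kirchhoff : dy e1 0 + dy e2 0 + dy e3 0 + dy e4 0 = 0.
Hypothesis y_far : forall i j, weight i * y i (len i) = weight j * y j (len j).
Hypothesis dy_far : weight e1 * dy e1 (len e1) + weight e2 * dy e2 (len e2)
  + weight e3 * dy e3 (len e3) + weight e4 * dy e4 (len e4) = 0.

Lemma neumann_extend v :
  neumann_at (extend y y) (extend dy (fun k x => - dy k x)) v.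
Proof.
rewrite /neumann_at /extend; have [ev|od] := boolP (even_vertex v).
  split=> [i j|]; first by rewrite (y_cont i j).
  by rewrite -!mulrDr y_kirchhoff mulr0.
have st k : phase (step v (opposite k)) = weight k * phase (step v e4).
  by rewrite step_opposite_shift phase_translate.
split=> [i j|].
  have vE k : phase (step v k) * y (opposite k) (len k - 0) =
      phase (step v e4) *
        (weight (opposite k) * y (opposite k) (len (opposite k))).
    by rewrite -{1}(opposite_opposite k) st subr0 edge_length_opposite; ring.
  by rewrite !vE (y_far (opposite i) (opposite j)).
rewrite (st e1) (st e2) (st e3) (st e4) !subr0 /=.
have /(congr1 ( *%R (- phase (step v e4)))) := dy_far; rewrite mulr0 => <- /=.
ring.
Qed.

Lemma bloch_eigenvalue_extend k t : 0 <= t <= len k -> y k t != 0 ->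
  bloch_eigenvalue a1 a2 q theta1 theta2 lam.
Proof.
move=> tk yt; have [ddy ddyP] := choice y_sol.
exists (extend y y); split; last first.
  exists (0, 0), k, t; split=> //.
  by rewrite /extend /= phase0 mul1r.
split.
- exact: is_graph_function_extend.
- by move=> v p j x _; rewrite extend_translate.
exists (extend dy (fun k x => - dy k x)), (extend ddy ddy); split.
- move=> v j; rewrite /extend; case ev : (even_vertex v).
    by apply: H2Z => //; exact: (ddyP j).1.
  have [H _] := ddyP (opposite j); rewrite edge_length_opposite in H.
  by apply: H2Z => //; exact: (H2_reflection (len_ge0 j) H).
- exact: neumann_extend.
- move=> v j; rewrite /ae_eq_on /potential -/(even_vertex v) /extend.
  have F := ae_filter_ringOfSetsType mu.
  case ev : (even_vertex v).
    have [_] := ddyP j; rewrite /ae_eq_on; apply: filterS => x /= Hx xj.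
    by rewrite mulrCA -Hx//; ring.
  have [_] := ddyP (opposite j); rewrite /ae_eq_on edge_length_opposite.
  move=> /(ae_reflection (len j)); apply: filterS => x /= Hx xj.
  by rewrite mulrCA -Hx; [ring|move: xj; lra].
Qed.

End Extension.

Unset Implicit Arguments.

Theorem theorem2p1 (R : realType) (a1 a2 : R) (a1_gt0 : 0 < a1) (a2_gt0 : 0 < a2)
    (q : edge -> R -> R) (q_L2 : forall j, L2_real (edge_length a1 a2 j) (q j))
    (* C j x rho = C_j(x, rho), dC j x rho = C_j'(x, rho), and likewise S, dS *)
    (C dC S dS : edge -> R -> R[i] -> R[i])
    (C_sol : forall j rho, ode_solution (edge_length a1 a2 j) (q j) (rho ^+ 2)
               (fun x => C j x rho) (fun x => dC j x rho))
    (C_init : forall j rho, C j 0 rho = 1 /\ dC j 0 rho = 0)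
    (S_sol : forall j rho, ode_solution (edge_length a1 a2 j) (q j) (rho ^+ 2)
               (fun x => S j x rho) (fun x => dS j x rho))
    (S_init : forall j rho, S j 0 rho = 0 /\ dS j 0 rho = 1)
    (theta1 theta2 : R)
    (theta1_pi : - pi <= theta1 <= pi) (theta2_pi : - pi <= theta2 <= pi)
    (rho : R[i]) :
  let c (j : edge) : R[i] * R[i] :=
    (C j (edge_length a1 a2 j) rho, dC j (edge_length a1 a2 j) rho) in
  let s (j : edge) : R[i] * R[i] :=
    (S j (edge_length a1 a2 j) rho, dS j (edge_length a1 a2 j) rho) in
  bloch_eigenvalue a1 a2 q theta1 theta2 (rho ^+ 2) <->
  leibniz4 (c e1) (s e2) (s e3) (s e4) + leibniz4 (s e1) (c e2) (s e3) (s e4)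
  + leibniz4 (s e1) (s e2) (c e3) (s e4) + leibniz4 (s e1) (s e2) (s e3) (c e4)
  = 2 * (((s e1).1 * (s e3).1 + (s e2).1 * (s e4).1) * (cos theta1)%:C
         + ((s e1).1 * (s e2).1 + (s e3).1 * (s e4).1) * (cos theta2)%:C
         + (s e2).1 * (s e3).1 * (cos (theta1 + theta2))%:C
         + (s e1).1 * (s e4).1 * (cos (theta1 - theta2))%:C).
Proof.
set len := edge_length a1 a2; set lam := rho ^+ 2 => c s.
have len_gt0 k : 0 < len k by exact: edge_length_gt0.
have len_ge0 k : 0 <= len k by exact/ltW.
have end_in k : 0 <= len k <= len k by rewrite lexx len_ge0.
pose w k := cis (angle theta1 theta2 (shift k)).
pose v k := cis (- angle theta1 theta2 (shift k)).
have wv k : w k * v k = 1 by exact: cisK.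
have W k : (c k).1 * (s k).2 - (c k).2 * (s k).1 = 1.
  exact: (wronskianCS (len_ge0 k) (C_sol k rho) (C_init k rho)
    (S_sol k rho) (S_init k rho)).
have sys := vertex_system_solvable (wv e1) (wv e2) (wv e3) (wv e4)
  (W e1) (W e2) (W e3) (W e4).
have wvE i j t :
    angle theta1 theta2 (shift i) - angle theta1 theta2 (shift j) = t ->
    w i * v j + w j * v i = 2 * (cos t)%:C.
  by move=> <-; rewrite /w /v -!cisD -cisDN opprB; congr (_ + cis _); rewrite addrC.
have dispersion_rhsE : dispersion_rhs (s e1).1 (s e2).1 (s e3).1 (s e4).1
    (w e1) (w e2) (w e3) (w e4)
    (v e1) (v e2) (v e3) (v e4) =
  2 * (((s e1).1 * (s e3).1 + (s e2).1 * (s e4).1) * (cos theta1)%:C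
         + ((s e1).1 * (s e2).1 + (s e3).1 * (s e4).1) * (cos theta2)%:C
         + (s e2).1 * (s e3).1 * (cos (theta1 + theta2))%:C
         + (s e1).1 * (s e4).1 * (cos (theta1 - theta2))%:C).
  rewrite /dispersion_rhs (wvE e1 e2 (- theta2)) ?(wvE e1 e3 (- theta1))
    ?(wvE e1 e4 (- (theta1 + theta2)))
    ?(wvE e2 e3 (theta2 - theta1)) ?(wvE e2 e4 (- theta1)) ?(wvE e3 e4 (- theta2));
    try by rewrite /angle /=; ring.
  by rewrite -(opprB theta1 theta2) !cosN; ring.
rewrite -dispersion_rhsE -/(dispersion_lhs _ _ _ _ _ _ _ _ _ _ _ _ _ _ _ _).
apply: iff_trans sys; split.
- move=> [y [[y_fun y_fb [dy [ddy [y_H2 y_neu y_ae]]]] [u [j [x [xj yx]]]]]].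
  pose y0 := y (0, 0); pose dy0 := dy (0, 0).
  have y_sol k : ode_solution (len k) (q k) lam (y0 k) (dy0 k).
    exists (ddy (0, 0) k); split; first exact: y_H2.
    have := y_ae (0, 0) k; rewrite /ae_eq_on; apply: filterS.
      exact: (ae_filter_ringOfSetsType lebesgue_measure).
    by move=> t /= + tk => /(_ tk) ->.
  have yE k := ode_solutionE (len_ge0 k) (C_sol k rho) (C_init k rho)
    (S_sol k rho) (S_init k rho) (y_sol k).
  have [y_far dy_far] :=
    far_vertex_conditions a1_gt0 a2_gt0 y_fun y_fb y_H2 y_neu.
  have [y_cont y_kir] := y_neu (0, 0).
  exists (y0 e1 0), (dy0 e1 0), (dy0 e2 0), (dy0 e3 0), (dy0 e4 0),
    (w e1 * y0 e1 (len e1)).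
  have y0E k : y0 k 0 = y0 e1 0 by exact: y_cont.
  have endE k : y0 e1 0 * (c k).1 + dy0 k 0 * (s k).1 = y0 k (len k).
    by rewrite -(y0E k) (yE k (len k) (end_in k)).1.
  have dendE k : y0 e1 0 * (c k).2 + dy0 k 0 * (s k).2 = dy0 k (len k).
    by rewrite -(y0E k) (yE k (len k) (end_in k)).2.
  split=> //.
  + have [k [t [tk]]] := nonzero_on_W y_fun y_fb xj yx.
    apply: contraNN => /and5P[/eqP A0 /eqP B1 /eqP B2 /eqP B3 /eqP B4].
    rewrite -/(y0 k t) (yE k t tk).1 y0E A0 mul0r add0r.
    have -> : dy0 k 0 = 0 by case: (k).
    by rewrite mul0r.
  + by split; rewrite endE; exact: y_far.
  + by rewrite !dendE; exact: dy_far.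
- move=> [A [B1 [B2 [B3 [B4 [E [nz kir [E1 E2 E3 E4] dfar]]]]]]].
  pose B k := match k with e1 => B1 | e2 => B2 | e3 => B3 | e4 => B4 end.
  pose y k x := A * C k x rho + B k * S k x rho.
  pose dy k x := A * dC k x rho + B k * dS k x rho.
  have y_sol k : ode_solution (len k) (q k) lam (y k) (dy k).
    exact: (ode_solution_comb (len_ge0 k) (C_sol k rho) (S_sol k rho)).
  have y0 k : y k 0 = A.
    by rewrite /y (C_init k rho).1 (S_init k rho).1 mulr1 mulr0 addr0.
  have dy0 k : dy k 0 = B k.
    by rewrite /dy (C_init k rho).2 (S_init k rho).2 mulr1 mulr0 add0r.
  have y_far k : w k * y k (len k) = E by case: k.
  have [k [t [tk yt]]] : exists k t, 0 <= t <= len k /\ y k t != 0.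
    apply: contraPP nz => /forallNP H; apply/negP; rewrite negbK.
    have {}H k t : 0 <= t <= len k -> y k t = 0.
      move=> tk; apply/eqP; apply: contrapT => /negP yt.
      by apply: (H k); exists t.
    have A0 : A = 0 by rewrite -(y0 e1) H// lexx len_ge0.
    have Bk k : B k = 0.
      have [ddy [y_H2 _]] := y_sol k.
      rewrite -dy0 (H2_unique (len_gt0 k) y_H2 (H2Z 0 (len_ge0 k) y_H2)) ?mul0r//.
        by move=> x xk; rewrite H// mul0r.
      by rewrite lexx len_ge0.
    have := (Bk e1, Bk e2, Bk e3, Bk e4); rewrite /B => -[[[-> ->] ->] ->].
    by rewrite A0 eqxx.
  apply: (bloch_eigenvalue_extend a1_gt0 a2_gt0 y_sol _ _ _ _ tk yt).
  + by move=> i j; rewrite !y0.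
  + by rewrite !dy0.
  + by move=> i j; rewrite -/(w i) -/(w j) !y_far.
  + exact: dfar.
Qed.
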